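(* Let $C$ be a locally finite EI category of type $\mathrm{A}_\infty$. Assume that $C$ satisfies the transitivity condition and the bijectivity condition, and let $\mathbf{k}$ be a field of characteristic $0$. Let $V$ be a finitely generated $\mathbf{k}C$-module. Then $V$ is a Noetherian $\mathbf{k}C$-module.
   Context: An EI category is a small category in which every endomorphism is an isomorphism; all EI categories here are assumed skeletal (isomorphic objects are equal). $C(i,j)$ denotes the set of morphisms from $i$ to $j$, and $G_i = C(i,i)$, which is a group. Composition is written as usual: for $\beta\in C(i,j)$ and $\alpha\in C(j,l)$, $\alpha\beta\in C(i,l)$. $C$ is locally finite if every $C(i,j)$ is a finite set. A morphism $\alpha$ is unfactorizable if it is not an isomorphism and whenever $\alpha=\beta_1\beta_2$ with $\beta_1,\beta_2$ morphisms of $C$, either $\beta_1$ or $\beta_2$ is an isomorphism. The quiver underlying $C$ has vertex set $\mathrm{Ob}(C)$ and exactly one arrow from $i$ to $j$ if there is an unfactorizable morphism from $i$ to $j$, and no arrow otherwise. $C$ is of type $\mathrm{A}_\infty$ if $\mathrm{Ob}(C)=\mathbb{Z}_+$ (the non-negative integers) and its underlying quiver is $0\to 1\to 2\to\cdots$ (i.e. the arrows are exactly $i\to i+1$, $i\in\mathbb{Z}_+$). Transitivity condition: for each $i\in\mathbb{Z}_+$, the action of $G_{i+1}$ on $C(i,i+1)$ by post-composition is transitive. Bijectivity condition (for $C$ satisfying the transitivity condition): fix a morphism $\alpha_i\in C(i,i+1)$ for each $i\in\mathbb{Z}_+$. For $i<j$ let $\alpha_{i,j}=\alpha_{j-1}\cdots\alpha_{i+1}\alpha_i\in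 C(i,j)$, let $H_{i,j}=\mathrm{Stab}_{G_j}(\alpha_{i,j})=\{g\in G_j : g\alpha_{i,j}=\alpha_{i,j}\}$, and let $m_{i,j}:C(i,j)\to C(i,j+1)$, $\gamma\mapsto\alpha_j\gamma$. The map $m_{i,j}$ sends each $H_{i,j}$-orbit $\mathscr{O}$ in $C(i,j)$ into a single $H_{i,j+1}$-orbit in $C(i,j+1)$, so it induces a map on orbit sets $\mu_{i,j}: H_{i,j}\backslash C(i,j)\to H_{i,j+1}\backslash C(i,j+1)$, where $\mu_{i,j}(\mathscr{O})$ is the $H_{i,j+1}$-orbit containing $m_{i,j}(\mathscr{O})$. The bijectivity condition says: for each $i\in\mathbb{Z}_+$, the map $\mu_{i,j}$ is bijective for all $j$ sufficiently large. (This is independent of the choice of the $\alpha_i$.) A $\mathbf{k}C$-module is a covariant functor from $C$ to the category of $\mathbf{k}$-modules; equivalently, a graded module $V=\bigoplus_{i\in\mathrm{Ob}(C)}V_i$ over the category algebra $\bigoplus_{i,j}\mathbf{k}C(i,j)$, with $V_i=\mathbf{1}_iV$, where $\mathbf{1}_i$ is the identity morphism of $i$. A $\mathbf{k}C$-module $V$ is finitely generated if there is a finite subset $S\subset V=\bigoplus_i V_i$ such that the only $\mathbf{k}C$-submodule of $V$ containing $S$ is $V$. $V$ is Noetherian if every $\mathbf{k}C$-submodule of $V$ is finitely generated. *)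

(* Defs.v *)
From HB Require Import structures.
From mathcomp Require Import all_boot all_algebra.

Set Implicit Arguments.
Unset Strict Implicit.
Unset Printing Implicit Defensive.

Import GRing.Theory.

(* Small categories with finite hom-sets; [compm f g] is "f after g". *)
Record lfCategory (Ob : Type) := LFCategory {
  hom : Ob -> Ob -> finType;
  idm : forall i, hom i i;
  compm : forall i j l, hom j l -> hom i j -> hom i l;
  comp1m : forall i j (f : hom i j), compm (idm j) f = f;
  compm1 : forall i j (f : hom i j), compm f (idm i) = f;
  compA : forall i j l n (f : hom l n) (g : hom j l) (h : hom i j),
    compm f (compm g h) = compm (compm f g) h }.

Arguments idm {Ob C} i : rename.
Arguments compm {Ob C i j l} f g : rename.

Declare Scope cat_scope.
Delimit Scope cat_scope with cat.
Notation "f \o g" := (compm f g) : cat_scope.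
Local Open Scope cat_scope.

Section Category.
Variables (Ob : Type) (C : lfCategory Ob).

Definition is_iso (i j : Ob) (f : hom C i j) : Prop :=
  exists g : hom C j i, g \o f = idm i /\ f \o g = idm j.

Definition EI : Prop := forall (i : Ob) (f : hom C i i), is_iso f.

Definition skeletal : Prop :=
  forall i j : Ob, (exists f : hom C i j, is_iso f) -> i = j.

Definition unfactorizable (i j : Ob) (f : hom C i j) : Prop :=
  ~ is_iso f /\
  forall (l : Ob) (f1 : hom C l j) (f2 : hom C i l),
    f = f1 \o f2 -> is_iso f1 \/ is_iso f2.

Definition quiver_arrow (i j : Ob) : Prop :=
  exists f : hom C i j, unfactorizable f.

End Category.

Section TypeA.
Variable C : lfCategory nat.

Definition type_Ainf : Prop :=
  forall i j : nat, quiver_arrow C i j <-> j = i.+1.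

Definition transitivity_condition : Prop :=
  forall (i : nat) (a b : hom C i i.+1), exists g : hom C i.+1 i.+1, g \o a = b.

Section Bijectivity.
Variable alpha : forall i, hom C i i.+1.

(* [chain i n] is alpha_{i,j} for j = n + i. Indexing by the offset n makes the
   recursive step well-typed: [n.+1 + i] is convertible to [(n + i).+1]. *)
Fixpoint chain (i n : nat) : hom C i (n + i) :=
  if n is n'.+1 then alpha (n' + i) \o chain i n' else idm i.

Definition stab (i n : nat) : {set hom C (n + i) (n + i)} :=
  [set g | g \o chain i n == chain i n].

Definition stab_orbit (i n : nat) (c : hom C i (n + i)) : {set hom C i (n + i)} :=
  [set g \o c | g in stab i n].

Definition stab_orbits (i n : nat) : {set {set hom C i (n + i)}} :=
  [set stab_orbit c | c : hom C i (n + i)].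

Definition step (i n : nat) (c : hom C i (n + i)) : hom C i (n.+1 + i) :=
  alpha (n + i) \o c.

(* The default [set0] is never used on [stab_orbits i n], see [mu_orbit]. *)
Definition mu (i n : nat) (O : {set hom C i (n + i)}) :
    {set hom C i (n.+1 + i)} :=
  odflt set0 [pick O' in stab_orbits i n.+1 | (@step i n) @: O \subset O'].

Definition mu_bijective (i n : nat) : Prop :=
  {in stab_orbits i n &, injective (@mu i n)} /\
  (@mu i n) @: stab_orbits i n = stab_orbits i n.+1.

Lemma mu_orbit (i n : nat) (c : hom C i (n + i)) :
  EI C -> transitivity_condition -> mu (stab_orbit c) = stab_orbit (step c).
Proof.
move=> CEI Ctr; rewrite /mu.
have idst m : idm (m + i) \in stab i m by rewrite inE comp1m.
have sub : @step i n @: stab_orbit c \subset stab_orbit (step c).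
  apply/subsetP => _ /imsetP[_ /imsetP[h hst ->] ->].
  have [g gE] := Ctr _ (alpha (n + i)) (alpha (n + i) \o h).
  apply/imsetP; exists g; last by rewrite /step !compA gE.
  by move: hst; rewrite !inE /= compA gE -compA => /eqP ->.
case: pickP => [O' /andP[/imsetP[d _ ->] sub'] | /(_ (stab_orbit (step c)))];
  last by rewrite sub andbT imset_f.
have : step c \in stab_orbit d.
  apply: (subsetP sub'); apply: imset_f; apply/imsetP.
  by exists (idm (n + i)); rewrite ?comp1m.
case/imsetP=> h; rewrite inE => /eqP hst ->.
have [k [kh hk]] := CEI _ h.
apply/setP => x; apply/imsetP/imsetP => -[g]; rewrite inE => /eqP gst ->.
  exists (g \o k); last by rewrite compA -(compA g) kh compm1.
  by rewrite inE -{1}hst compA -(compA g) kh compm1 gst.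
by exists (g \o h); rewrite ?compA // inE -compA hst gst.
Qed.

End Bijectivity.

(* The condition does not depend on the choice of the morphisms [alpha i]. *)
Definition bijectivity_condition : Prop :=
  exists alpha : forall i, hom C i i.+1,
  forall i : nat, exists N : nat, forall n : nat, N <= n ->
    mu_bijective alpha i n.

End TypeA.

Local Open Scope ring_scope.

Record catModule (k : nzRingType) (Ob : Type) (C : lfCategory Ob) := CatModule {
  comp_of :> Ob -> lmodType k;
  act : forall i j, hom C i j -> {linear comp_of i -> comp_of j};
  act1 : forall i (x : comp_of i), act (idm i) x = x;
  actM : forall i j l (f : hom C j l) (g : hom C i j) (x : comp_of i),
    act (f \o g) x = act f (act g x) }.

Section CatModule.
Variables (k : nzRingType) (Ob : eqType) (C : lfCategory Ob).
Variable V : catModule k C.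

(* The direct sum of the V_i: families with finite support. *)
Record dsum := DSum {
  dsum_fun :> forall i, V i;
  dsum_fin : exists s : seq Ob, forall i, i \notin s -> dsum_fun i = 0 }.

(* Submodules are automatically graded, since the identities 1_i belong to the
   category algebra; hence a submodule is a family of subspaces of the V_i. *)
Record submodule := Submodule {
  sub_of :> forall i, V i -> Prop;
  sub0 : forall i, sub_of (0 : V i);
  subD : forall i (x y : V i), sub_of x -> sub_of y -> sub_of (x + y);
  subZ : forall i (a : k) (x : V i), sub_of x -> sub_of (a *: x);
  sub_act : forall i j (f : hom C i j) (x : V i),
    sub_of x -> sub_of (act V f x) }.

Definition sub_mem (W : submodule) (v : dsum) : Prop := forall i, W i (v i).

Definition sub_le (U W : submodule) : Prop := forall i (x : V i), U i x -> W i x.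

Definition sub_full : submodule :=
  @Submodule (fun _ _ => True) (fun _ => I) (fun _ _ _ _ _ => I)
    (fun _ _ _ _ => I) (fun _ _ _ _ _ => I).

(* [W], seen as a module, is finitely generated: its submodules are the
   submodules of [V] contained in [W]. *)
Definition fg_submodule (W : submodule) : Prop :=
  exists (m : nat) (S : 'I_m -> dsum),
    (forall e, sub_mem W (S e)) /\
    forall U : submodule,
      sub_le U W -> (forall e, sub_mem U (S e)) -> sub_le W U.

Definition finitely_generated : Prop := fg_submodule sub_full.

Definition noetherian : Prop := forall W : submodule, fg_submodule W.

End CatModule.

(* Main.v *)
(* For a submodule [X] of the free module [kC(i, -)], Maschke's theorem shows
   that X_j is generated over G_j by its vectors fixed by H_{i,j}.  By the
   bijectivity condition and characteristic 0, multiplying by alpha_j and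
   summing over H_{i,j+1} is, for large j, an injective map from the invariants
   of kC(i, j) to those of kC(i, j + 1), whose dimension, the number of
   H_{i,j}-orbits, stays bounded.  So the dimension of the invariants of X_j is
   eventually constant, the transfer map is onto the invariants of X_{j+1}, and
   X_{j+1} is generated by X_j.  Hence free modules are Noetherian, and a
   finitely generated module is reached by adjoining one generator at a time. *)
From HB Require Import structures.
From mathcomp Require Import all_boot all_algebra.
From Stdlib Require Import ClassicalEpsilon.
Require Import Defs.

Set Implicit Arguments.
Unset Strict Implicit.
Unset Printing Implicit Defensive.

Import GRing.Theory.

(** * Invertibility of morphisms in an EI category *)

Section Morphisms.
Local Open Scope cat_scope.
Variables (Ob : Type) (C : lfCategory Ob).
Hypothesis C_EI : EI C.

(** The endomorphisms [g \o f] and [f \o g] are invertible, so [f] has a left inverse [u \o g] and a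
    right inverse [g \o w], which coincide. *)
Lemma EI_iso (i j : Ob) (f : hom C i j) (g : hom C j i) : is_iso f.
Proof.
have [u [uK _]] := C_EI (g \o f); have [w [_ wK]] := C_EI (f \o g).
have E : u \o g = g \o w.
  have ugf : (u \o g) \o f = idm i by rewrite -compA.
  by rewrite -[LHS]compm1 -wK !compA ugf comp1m.
by exists (u \o g); rewrite -compA uK {1}E compA.
Qed.

Definition inv_endo (i : Ob) (g : hom C i i) : hom C i i :=
  odflt g [pick h | (h \o g == idm i) && (g \o h == idm i)].

Lemma inv_endoP (i : Ob) (g : hom C i i) :
  inv_endo g \o g = idm i /\ g \o inv_endo g = idm i.
Proof.
rewrite /inv_endo; case: pickP => [h /andP[/eqP-> /eqP->] //|no].
by have [h [hg gh]] := C_EI g; move: (no h); rewrite hg gh !eqxx.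
Qed.

Lemma compm_inj (i j : Ob) (g : hom C j j) : injective (@compm Ob C i j j g).
Proof.
move=> a b /(congr1 (compm (inv_endo g))).
by rewrite !compA (inv_endoP g).1 !comp1m.
Qed.

End Morphisms.

(** * Factorization and transitivity in type A_infinity *)

Section TypeAinf.
Local Open Scope cat_scope.
Variable C : lfCategory nat.
Hypotheses (C_EI : EI C) (C_skel : skeletal C) (C_Ainf : type_Ainf C).
Hypothesis C_trans : transitivity_condition C.
Variable alpha : forall i, hom C i i.+1.

(** If [j < i], the chain of [alpha] runs from [j] back to [i], so [f] is invertible and skeletality
    forces [i = j]. *)
Lemma hom_leq (i j : nat) (f : hom C i j) : i <= j.
Proof.
rewrite leqNgt; apply/negP => ltji.
have g : hom C j i by rewrite -(subnK (ltnW ltji)); exact: chain alpha j (i - j).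
have ij : i = j by apply: C_skel; exists f; exact: (EI_iso C_EI f g).
by rewrite ij ltnn in ltji.
Qed.

Lemma hom_lt (i j : nat) (f : hom C i j) : ~ is_iso f -> i < j.
Proof.
move=> nf; rewrite ltn_neqAle (hom_leq f) andbT; apply/eqP => ij.
by case: nf; move: f; rewrite -ij => f; exact: C_EI.
Qed.

(** Induction on the gap [j.+1 - i]. An unfactorizable [f] is an arrow of the quiver, so [i = j];
    otherwise both factors strictly raise the object and the induction applies to the left one. *)
Lemma hom_factor (i j : nat) (f : hom C i j.+1) : i <= j ->
  exists (g : hom C j j.+1) (h : hom C i j), f = g \o h.
Proof.
have [d] := ubnP (j.+1 - i); elim: d i f => // d IHd i f lt_d leij.
have nf : ~ is_iso f.
  by move=> isof; move: leij; rewrite (C_skel (ex_intro _ f isof)) ltnn.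
have [unf | fac] := classic (unfactorizable f).
  have [Eij] : j.+1 = i.+1 by apply/C_Ainf; exists f.
  by move: f {nf unf}; rewrite -Eij => f; exists f, (idm j); rewrite compm1.
have [l [f1 [f2 [fE [nf1 nf2]]]]] : exists l (f1 : hom C l j.+1) (f2 : hom C i l),
    f = f1 \o f2 /\ ~ is_iso f1 /\ ~ is_iso f2.
  apply: NNPP => nofac; case: fac; split=> // l f1 f2 fE.
  apply: NNPP => /not_or_and[nf1 nf2].
  by apply: nofac; exists l, f1, f2.
have lt_il := hom_lt nf2; have lt_lj := hom_lt nf1.
have [|//|g [h f1E]] := IHd l f1.
  by rewrite -ltnS; apply: leq_trans lt_d; rewrite ltnS ltn_sub2l // ltnW.
by exists g, (h \o f2); rewrite fE f1E compA.
Qed.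

(** [hom_factor] peels off the last step; transitivity on that step absorbs the group element given
    by the induction. *)
Lemma chain_transitive (i n : nat) (f : hom C i (n + i)) :
  exists g : hom C (n + i) (n + i), g \o chain alpha i n = f.
Proof.
elim: n f => [|n IHn] f; first by exists f; rewrite compm1.
have [g [h ->]] := hom_factor f (leq_addl n i).
have [g' <-] := IHn h.
have [g'' E] := C_trans (alpha (n + i)) (g \o g').
by exists g''; rewrite /= !compA E.
Qed.

End TypeAinf.

(** * Subspaces and bounded integer sequences *)

Local Open Scope ring_scope.

(** Gives submodules, which are mere predicates, a dimension in each degree. Were there no such [U],
    subspaces inside [P] could be enlarged forever, beyond the dimension of [vT]. *)
Lemma vspace_of_predicate (k : fieldType) (vT : vectType k) (P : vT -> Prop) :
  P 0 -> (forall x y, P x -> P y -> P (x + y)) ->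
  (forall a x, P x -> P (a *: x)) ->
  exists U : {vspace vT}, forall x, x \in U <-> P x.
Proof.
move=> P0 PD PZ.
suff [U [UP Umax]] : exists U : {vspace vT}, (forall x, x \in U -> P x) /\
    forall x, P x -> x \in U.
  by exists U => x; split; [exact: UP | exact: Umax].
apply: NNPP => no.
have grow n : exists U : {vspace vT}, (forall x, x \in U -> P x) /\ (n <= \dim U)%N.
  elim: n => [|n [U [UP leU]]].
    by exists 0%VS; split=> // x; rewrite memv0 => /eqP->.
  have [x [Px xU]] : exists x, P x /\ ~ (x \in U).
    apply: NNPP => nox; apply: no; exists U; split=> // x Px.
    by apply: NNPP => xU; apply: nox; exists x.
  exists (U + <[x]>)%VS; split.
    by move=> _ /memv_addP[u uU [_ /vlineP[a ->] ->]]; apply: PD; auto.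
  apply: leq_ltn_trans leU _; rewrite ltn_neqAle.
  rewrite dimvS ?addvSl // andbT; apply/negP => Edim.
  have [_] := dimv_leqif_eq (addvSl U <[x]>); rewrite Edim => /esym/eqP EU.
  by apply: xU; rewrite EU memvE addvSr.
have [U [_]] := grow (\dim {:vT}).+1.
by rewrite ltnNge dimvS ?subvf.
Qed.

Lemma bounded_nondecreasing_stationary (d : nat -> nat) (N B : nat) :
  (forall n, N <= n -> d n <= d n.+1)%N -> (forall n, N <= n -> d n <= B)%N ->
  exists2 M, (N <= M)%N & forall n, (M <= n)%N -> d n.+1 = d n.
Proof.
move=> dle dB; apply: NNPP => no.
have grow e : exists2 n, (N <= n)%N & (e <= d n)%N.
  elim: e => [|e [n leNn led]]; first by exists N.
  apply: NNPP => no'; apply: no; exists n => // m lenm.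
  (* If [d] never exceeds [e] past [N], it is constant from [n] on, against [no]. *)
  have d_e p : (n <= p)%N -> d p = e.
    elim: p => [|p IHp] lenp; apply/eqP; rewrite eqn_leq.
      apply/andP; split.
        rewrite leqNgt; apply/negP => lt; apply: no'; exists 0 => //.
        exact: leq_trans lenp.
      by move: lenp led; rewrite leqn0 => /eqP->.
    apply/andP; split.
      rewrite leqNgt; apply/negP => lt; apply: no'; exists p.+1 => //.
      exact: leq_trans lenp.
    move: lenp; rewrite leq_eqVlt => /predU1P[<- //|]; rewrite ltnS => lenp.
    by rewrite -[X in (X <= _)%N](IHp lenp) dle // (leq_trans leNn).
  by rewrite !d_e // ltnW.
have [n leNn] := grow B.+1.
by rewrite ltnNge dB.
Qed.

(** * The free module kC(i, -) and averaging over G_j *)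

Section FreeModule.
Variables (k : fieldType) (Ob : Type) (C : lfCategory Ob) (i : Ob).

Notation A j := {ffun hom C i j -> k^o}.

(** With kC(i, j) coded as functions on [hom C i j], this is the linear extension of
    post-composition by [f]. *)
Definition push (j l : Ob) (f : hom C j l) (x : A j) : A l :=
  [ffun b => \sum_(a | (f \o a)%cat == b) x a].

Lemma push_is_linear (j l : Ob) (f : hom C j l) : linear (push f).
Proof.
move=> a x y; apply/ffunP => b; rewrite !ffunE scaler_sumr -big_split /=.
by apply: eq_bigr => c _; rewrite !ffunE.
Qed.

HB.instance Definition _ (j l : Ob) (f : hom C j l) :=
  GRing.isLinear.Build k (A j) (A l) *:%R (push f) (push_is_linear f).

Lemma push1 (j : Ob) (x : A j) : push (idm j) x = x.
Proof.
apply/ffunP => b; rewrite ffunE (big_pred1 b) // => a /=.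
by rewrite comp1m.
Qed.

Lemma pushM (j l n : Ob) (f : hom C l n) (g : hom C j l) (x : A j) :
  push (f \o g)%cat x = push f (push g x).
Proof.
apply/ffunP => b; rewrite !ffunE.
rewrite (partition_big (fun a => (g \o a)%cat) (fun c => (f \o c)%cat == b)) /=.
  apply: eq_bigr => c /eqP <-; rewrite ffunE; apply: eq_bigl => a.
  by rewrite -compA andb_idl // => /eqP->.
by move=> a; rewrite compA.
Qed.

Definition free_module : catModule k C :=
  @CatModule k Ob C (fun j => A j) (fun j l f => push f) push1 pushM.

Definition delta (j : Ob) (c : hom C i j) : A j := [ffun a => (a == c)%:R].

Lemma push_delta (j l : Ob) (f : hom C j l) (c : hom C i j) :
  push f (delta c) = delta (f \o c)%cat.
Proof.
apply/ffunP => b; rewrite !ffunE big_mkcond (bigD1 c) //= big1 ?addr0 => [|a ne].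
  by rewrite ffunE eqxx eq_sym; case: eqP.
by rewrite ffunE (negPf ne) if_same.
Qed.

Lemma delta_sum (j : Ob) (x : A j) : x = \sum_c x c *: delta c.
Proof.
apply/ffunP => b; rewrite sum_ffunE (bigD1 b) //= big1 ?addr0 => [|a ne].
  by rewrite !ffunE eqxx /= [LHS](esym (mulr1 _)).
by rewrite !ffunE eq_sym (negPf ne) scaler0.
Qed.

Hypotheses (C_EI : EI C) (k_char0 : [pchar k] =i pred0).

(* Maschke's theorem: averaging a projection onto [X] over G_j gives an
   equivariant projection, and it maps [delta c0] to a vector fixed by the
   stabilizer of [c0] whose G_j-translates span [X]. *)
Lemma invariants_generate (j : Ob) (c0 : hom C i j) (X U : {vspace A j}) :
  (forall c : hom C i j, exists g : hom C j j, (g \o c0)%cat = c) ->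
  (forall (g : hom C j j) x, x \in X -> push g x \in X) ->
  (forall (g : hom C j j) x, x \in U -> push g x \in U) ->
  (forall y, y \in X ->
    (forall g : hom C j j, (g \o c0)%cat = c0 -> push g y = y) -> y \in U) ->
  (X <= U)%VS.
Proof.
move=> tr Xst Ust inv_U.
(* The average is left undivided: [pi] multiplies by [#|hom C j j|] on [X], a factor that
   characteristic 0 allows to cancel at the end. *)
pose pi := \sum_(h : hom C j j)
  (linfun (push h) \o projv X \o linfun (push (inv_endo h)))%VF.
have piE x : pi x = \sum_h push h (projv X (push (inv_endo h) x)).
  by rewrite sum_lfunE; apply: eq_bigr => h _; rewrite !comp_lfunE !lfunE.
have piX x : pi x \in X.
  by rewrite piE; apply: memv_suml => h _; apply: Xst; apply: memv_proj.
have pig g x : push g (pi x) = pi (push g x).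
  rewrite !piE linear_sum [RHS](reindex_inj (compm_inj C_EI (g := g))) /=.
  apply: eq_bigr => h _; rewrite -!pushM; congr (push _ (projv X (push _ x))).
  (* It remains to see that [inv_endo h] is [inv_endo (g \o h) \o g]; composing both with [h], then
     with [g], gives [g]. *)
  have [ghl _] := inv_endoP C_EI (g \o h)%cat.
  apply: (compm_inj C_EI (g := h)); rewrite (inv_endoP C_EI h).2.
  apply: (compm_inj C_EI (g := g)); rewrite compm1 !compA.
  by rewrite (inv_endoP C_EI (g \o h)%cat).2 comp1m.
have piU c : pi (delta c) \in U.
  have [g <-] := tr c; rewrite -push_delta -pig; apply/Ust/inv_U => // h hc0.
  by rewrite pig push_delta hc0.
apply/subvP => x xX.
have E : pi x = #|hom C j j|%:R *: x.
  rewrite piE (eq_bigr (fun=> x)) ?sumr_const ?scaler_nat // => h _.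
  by rewrite projv_id ?Xst // -pushM (inv_endoP C_EI h).2 push1.
have nz : #|hom C j j|%:R != 0 :> k.
  by rewrite ((pcharf0P _).1 k_char0) -lt0n; apply/card_gt0P; exists (idm j).
rewrite -[x](scalerK nz) -E memvZ // [x]delta_sum linear_sum /=.
by apply: memv_suml => c _; rewrite linearZ /= memvZ.
Qed.

End FreeModule.

(** * Orbits of the stabilizers H_{i,j} *)

Section Stabilizers.
Local Open Scope cat_scope.
Variables (C : lfCategory nat) (alpha : forall i, hom C i i.+1) (i n : nat).
Hypothesis C_EI : EI C.

Lemma id_stab : idm (n + i)%N \in stab alpha i n.
Proof. by rewrite inE comp1m. Qed.

Lemma stab_compm (g h : hom C (n + i)%N (n + i)%N) :
  g \in stab alpha i n -> (g \o h \in stab alpha i n) = (h \in stab alpha i n).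
Proof.
rewrite !inE -compA => /eqP gst; rewrite -[X in _ == X]gst.
by rewrite (inj_eq (compm_inj C_EI (g := g))).
Qed.

Lemma stab_orbit_self (c : hom C i (n + i)%N) : c \in stab_orbit alpha c.
Proof. by apply/imsetP; exists (idm (n + i)%N); rewrite ?id_stab ?comp1m. Qed.

Lemma stab_orbit_eq (c d : hom C i (n + i)%N) :
  c \in stab_orbit alpha d -> stab_orbit alpha c = stab_orbit alpha d.
Proof.
case/imsetP=> h hst ->{c}; have [vh hv] := inv_endoP C_EI h.
apply/setP => x; apply/imsetP/imsetP => -[g gst ->].
  by exists (g \o h); rewrite ?compA // stab_compm.
exists (g \o inv_endo h); last by rewrite compA -(compA g) vh compm1.
rewrite stab_compm // -(stab_compm _ hst) hv; exact: id_stab.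
Qed.

End Stabilizers.

(** * Stabilization of submodules of free modules *)

Section Stabilization.
Variable C : lfCategory nat.
Hypotheses (C_EI : EI C) (C_skel : skeletal C) (C_Ainf : type_Ainf C).
Hypothesis C_trans : transitivity_condition C.
Variables (alpha : forall i, hom C i i.+1) (k : fieldType).
Hypothesis k_char0 : [pchar k] =i pred0.
Variable i : nat.

Notation A n := {ffun hom C i (n + i)%N -> k^o}.

Definition invariant (n : nat) (x : A n) : Prop :=
  forall h, h \in stab alpha i n -> push h x = x.

Lemma invariant_orbit (n : nat) (x : A n) (c d : hom C i (n + i)%N) :
  invariant x -> c \in stab_orbit alpha d -> x c = x d.
Proof.
move=> xinv /imsetP[h hst ->]; rewrite -{1}(xinv h hst) ffunE.
by rewrite (big_pred1 d) // => a /=; rewrite (inj_eq (compm_inj C_EI (g := h))).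
Qed.

(** Invariant functions are constant on orbits, hence spanned by the indicators of orbits. *)
Lemma dim_invariants (n : nat) (Y : {vspace A n}) :
  (forall x, x \in Y -> invariant x) ->
  (\dim Y <= #|stab_orbits alpha i n|)%N.
Proof.
move=> Yinv.
pose ind (Q : {set hom C i (n + i)%N}) : A n := [ffun c => (c \in Q)%:R].
pose B := [seq ind Q | Q <- enum (stab_orbits alpha i n)].
have sB : size B = #|stab_orbits alpha i n| by rewrite size_map cardE.
rewrite -sB; apply: leq_trans (dim_span B); apply/dimvS/subvP => x xY.
(* The default is never reached on an orbit, which is nonempty. *)
pose rep (Q : {set hom C i (n + i)%N}) := odflt (chain alpha i n) [pick c in Q].
have -> : x = \sum_(Q in stab_orbits alpha i n) x (rep Q) *: ind Q.
  apply/ffunP => c; rewrite sum_ffunE (bigD1 (stab_orbit alpha c)) ?imset_f //=.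
  rewrite big1 => [|Q /andP[/imsetP[d _ ->] neq]].
    rewrite !ffunE stab_orbit_self addr0 [RHS]mulr1.
    apply/esym/invariant_orbit; first exact: Yinv.
    rewrite /rep; case: pickP => //= /(_ c).
    by rewrite stab_orbit_self.
  rewrite !ffunE; case: (boolP (c \in _)) => [cd|]; last by rewrite scaler0.
  by rewrite (stab_orbit_eq C_EI cd) eqxx in neq.
apply: memv_suml => Q Qorb; apply/memvZ/memv_span/map_f.
by rewrite mem_enum.
Qed.

(* On orbit sums this is mu_{i,i+n}, up to nonzero integer factors. *)
Definition transfer (n : nat) : 'Hom(A n, A n.+1) :=
  (\sum_(h in stab alpha i n.+1)
    (linfun (push h) \o linfun (push (alpha (n + i)%N))))%VF.

Lemma transferE (n : nat) (x : A n) :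
  transfer n x = \sum_(h in stab alpha i n.+1) push h (push (alpha (n + i)%N) x).
Proof.
by rewrite sum_lfunE; apply: eq_bigr => h _; rewrite comp_lfunE !lfunE.
Qed.

Lemma transfer_invariant (n : nat) (x : A n) : invariant (transfer n x).
Proof.
move=> g gst; rewrite transferE linear_sum /=.
rewrite [RHS](reindex_inj (compm_inj C_EI (g := g))) /=.
by apply: eq_big => [h | h _]; [rewrite (stab_compm C_EI _ gst) | rewrite -pushM].
Qed.

(** Evaluate at [step alpha c]: by injectivity of [mu], only the orbit of [c] contributes, so the
    value is a positive multiple of [x c], and characteristic 0 applies. *)
Lemma transfer_inj (n : nat) (x : A n) :
  mu_bijective alpha i n -> invariant x -> transfer n x = 0 -> x = 0.
Proof.
move=> [mu_inj _] xinv /ffunP Fx0; apply/ffunP => c.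
have := Fx0 (step alpha c); rewrite transferE sum_ffunE !ffunE.
have same_orbit (h : hom C (n.+1 + i)%N (n.+1 + i)%N) a : h \in stab alpha i n.+1 ->
    ((h \o alpha (n + i)%N) \o a)%cat == step alpha c -> x a = x c.
  move=> hst /eqP E; apply: invariant_orbit xinv _.
  suff -> : stab_orbit alpha c = stab_orbit alpha a by exact: stab_orbit_self.
  apply: mu_inj; rewrite ?imset_f // !mu_orbit //.
  apply: stab_orbit_eq => //; apply/imsetP; exists h => //.
  by rewrite -E -compA.
pose m := (\sum_(h in stab alpha i n.+1)
  #|[pred a | ((h \o alpha (n + i)%N) \o a)%cat == step alpha c]|)%N.
rewrite (_ : \sum_(h in _) _ = x c *+ m); last first.
  rewrite /m -sumrMnr; apply: eq_bigr => h hst.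
  rewrite -pushM ffunE -sumr_const; apply: eq_bigr => a; exact: same_orbit.
rewrite -mulr_natr => /eqP; rewrite mulf_eq0 ((pcharf0P _).1 k_char0).
(* The pair of [h] the identity and [a = c] is counted in [m], so [m] is nonzero. *)
case/predU1P=> [//|]; rewrite /m sum_nat_eq0 => /forall_inP/(_ _ (id_stab _ _ _)).
by move/eqP/card0_eq/(_ c); rewrite inE comp1m eqxx.
Qed.

(** Quantifying over all submodules [U] expresses that X in degree [n + i] generates X in degree
    [n.+1 + i]; the bound [M] is uniform in [U]. *)
Lemma free_module_stabilizes (N : nat) (X : submodule (free_module k C i)) :
  (forall n, (N <= n)%N -> mu_bijective alpha i n) ->
  exists M, forall n (U : submodule (free_module k C i)), (M <= n)%N ->
    (forall x, X (n + i)%N x -> U (n + i)%N x) ->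
    forall x, X (n.+1 + i)%N x -> U (n.+1 + i)%N x.
Proof.
move=> bij.
have spanE (W : submodule (free_module k C i)) n :
    exists E : {vspace A n}, forall x, x \in E <-> W (n + i)%N x.
  exact: vspace_of_predicate (sub0 W _) (@subD _ _ _ _ W _) (@subZ _ _ _ _ W _).
(* [Y n] is the space of invariants of X in degree [n + i]. *)
have [Y YE] : exists Y : forall n, {vspace A n},
    forall n x, x \in Y n <-> X (n + i)%N x /\ invariant x.
  suff Yex n : exists Y : {vspace A n},
      forall x, x \in Y <-> X (n + i)%N x /\ invariant x.
    exists (fun n => proj1_sig (constructive_indefinite_description _ (Yex n))).
    by move=> n x; case: constructive_indefinite_description.
  apply: vspace_of_predicate => [|x y [Xx xinv] [Xy yinv]|a x [Xx xinv]].
  - by split=> [|h _]; [exact: sub0 | rewrite linear0].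
  - by split=> [|h hst]; [exact: subD | rewrite linearD /= xinv ?yinv].
  - by split=> [|h hst]; [exact: subZ | rewrite linearZ /= xinv].
have stable (W : submodule (free_module k C i)) n x :
    W (n + i)%N x -> W (n.+1 + i)%N (transfer n x).
  move=> Wx; rewrite transferE; apply: (big_ind (W (n.+1 + i)%N)).
  - exact: sub0.
  - exact: subD.
  - by move=> h _; apply: (sub_act h); apply: (sub_act (alpha (n + i)%N)).
have YS n : (transfer n @: Y n <= Y n.+1)%VS.
  apply/subvP => _ /memv_imgP[x /YE[Xx _] ->].
  by apply/YE; split; [exact: stable | exact: transfer_invariant].
have dimY n : (N <= n)%N -> \dim (transfer n @: Y n) = \dim (Y n).
  move=> leNn; apply: limg_dim_eq; apply/eqP; rewrite -subv0; apply/subvP => x.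
  rewrite memv_cap memv_ker memv0 => /andP[/YE[_ xinv] /eqP Fx0].
  by apply/eqP; apply: transfer_inj Fx0 => //; exact: bij.
have [|n leNn|M leNM dimM] := @bounded_nondecreasing_stationary
    (fun n => \dim (Y n)) N #|stab_orbits alpha i N|.
- by move=> n leNn /=; rewrite -dimY // dimvS.
- apply: leq_trans (dim_invariants (fun x xY => ((YE n x).1 xY).2)) _.
  (* Surjectivity of [mu] keeps the number of orbits from growing past [N]. *)
  elim: n leNn => [|n IHn]; first by rewrite leqn0 => /eqP->.
  rewrite leq_eqVlt => /predU1P[-> //|]; rewrite ltnS => leNn.
  by apply: leq_trans (IHn leNn); rewrite -(bij n leNn).2 leq_imset_card.
exists M => n U leMn XU x Xx.
have [EX EXP] := spanE X n.+1; have [EU EUP] := spanE U n.+1.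
apply/EUP; move/EXP: Xx; apply/subvP.
apply: (invariants_generate C_EI k_char0 (c0 := chain alpha i n.+1)).
- exact: chain_transitive.
- by move=> g y /EXP Xy; apply/EXP; apply: (sub_act g).
- by move=> g y /EUP Uy; apply/EUP; apply: (sub_act g).
move=> y /EXP Xy yinv; apply/EUP.
have : y \in Y n.+1.
  by apply/YE; split=> // h; rewrite inE => /eqP; exact: yinv.
(* An inclusion between spaces of equal dimension: every invariant [y] is a transfer from degree
   [n + i], where X lies in [U]. *)
have /eqP <- : (transfer n @: Y n == Y n.+1)%VS.
  by rewrite eqEdim YS dimY ?(leq_trans leNM) //= -(dimM n leMn).
by case/memv_imgP=> z /YE[Xz _] ->; apply/stable/XU.
Qed.

End Stabilization.

(** * Homogeneous generators and constructions of submodules *)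

Section HomogeneousGenerators.
Variables (k : fieldType) (Ob : eqType) (C : lfCategory Ob) (V : catModule k C).

Definition homogeneous (j : Ob) (v : V j) : {j : Ob & V j} := existT _ j v.

Definition contains_all (W : submodule V) (s : seq {j : Ob & V j}) : Prop :=
  forall p, p \in s -> W (tag p) (tagged p).

Definition hom_generated (W : submodule V) : Prop :=
  exists s, contains_all W s /\
    forall U : submodule V, contains_all U s -> sub_le W U.

Lemma contains_all_cons (W : submodule V) (p : {j : Ob & V j}) s :
  contains_all W (p :: s) <-> W (tag p) (tagged p) /\ contains_all W s.
Proof.
split=> [Wps | [Wp Ws] q].
  by split=> [|q qs]; apply: Wps; rewrite inE ?eqxx ?qs ?orbT.
by rewrite inE => /predU1P[-> //|]; exact: Ws.
Qed.

Lemma contains_all_cat (W : submodule V) s t :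
  contains_all W (s ++ t) <-> contains_all W s /\ contains_all W t.
Proof.
split=> [Wst | [Ws Wt] q].
  by split=> q qs; apply: Wst; rewrite mem_cat qs ?orbT.
by rewrite mem_cat => /orP[]; [exact: Ws | exact: Wt].
Qed.

Definition dsum_single (j : Ob) (v : V j) : dsum V.
Proof.
exists (@dfwith Ob (fun j => V j) (fun j => 0) j v); exists [:: j] => i; rewrite inE => neq.
by rewrite dfwith_out // eq_sym.
Defined.

Lemma sub_mem_single (W : submodule V) (j : Ob) (v : V j) :
  sub_mem W (dsum_single v) <-> W j v.
Proof.
split=> [/(_ j) | Wv i] /=; first by rewrite dfwith_in.
by case: dfwithP => // l _; exact: sub0.
Qed.

Lemma hom_generated_fg (W : submodule V) : hom_generated W -> fg_submodule W.
Proof.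
case=> s [Ws genW].
exists (size s), (fun e => dsum_single (tagged (tnth (in_tuple s) e))).
split=> [e | U _ US]; first by apply/sub_mem_single/Ws; exact: mem_tnth.
apply: genW => p /(tnthP (in_tuple s))[e ->].
exact/sub_mem_single.
Qed.

(** The components of the generators over their finite supports suffice, all others being zero. *)
Lemma finitely_generated_hom :
  finitely_generated V -> hom_generated (sub_full V).
Proof.
case=> m [S [_ genS]].
pose supp e := proj1_sig (constructive_indefinite_description _ (dsum_fin (S e))).
exists [seq homogeneous (S e j) | e <- enum 'I_m, j <- supp e]; split=> // U Us.
apply: genS => // e j; have [js | js] := boolP (j \in supp e).
  have := Us (homogeneous (S e j)); apply.
  by apply: (allpairs_f_dep (fun e j => homogeneous (S e j))); rewrite ?mem_enum.
have -> : S e j = 0; last exact: sub0.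
by move: js; rewrite /supp; case: constructive_indefinite_description => t /=; apply.
Qed.

(** As in the Yoneda lemma, [comb v] is the module map from kC(i, -) to [V] sending the identity of
    [i] to [v]. *)
Definition comb (i j : Ob) (v : V i) (a : {ffun hom C i j -> k^o}) : V j :=
  \sum_f a f *: act V f v.

Lemma combD (i j : Ob) (v : V i) (a b : {ffun hom C i j -> k^o}) :
  comb v (a + b) = comb v a + comb v b.
Proof.
by rewrite /comb -big_split; apply: eq_bigr => f _; rewrite ffunE scalerDl.
Qed.

Lemma combZ (i j : Ob) (v : V i) c (a : {ffun hom C i j -> k^o}) :
  comb v (c *: a) = c *: comb v a.
Proof.
by rewrite /comb scaler_sumr; apply: eq_bigr => f _; rewrite ffunE scalerA.
Qed.

Lemma comb0 (i j : Ob) (v : V i) : comb v (0 : {ffun hom C i j -> k^o}) = 0.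
Proof. by rewrite -(scale0r 0) combZ scale0r. Qed.

Lemma comb_push (i j l : Ob) (v : V i) (f : hom C j l) a :
  comb v (push f a) = act V f (comb v a).
Proof.
rewrite /comb linear_sum (partition_big (fun g => (f \o g)%cat) xpredT) //=.
apply: eq_bigr => g _; rewrite ffunE scaler_suml; apply: eq_bigr => h /eqP <-.
by rewrite linearZ /= actM.
Qed.

Lemma comb_id (i : Ob) (v : V i) : comb v (delta k (idm i)) = v.
Proof.
rewrite /comb (bigD1 (idm i)) //= big1 ?addr0 => [|f neq].
  by rewrite ffunE eqxx scale1r act1.
by rewrite ffunE (negPf neq) scale0r.
Qed.

Definition sub_zero : submodule V.
Proof.
exists (fun j x => x = 0) => //.
- by move=> i x y -> ->; rewrite addr0.
- by move=> i a x ->; rewrite scaler0.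
- by move=> i j f x ->; rewrite linear0.
Defined.

Definition sub_cap (U W : submodule V) : submodule V.
Proof.
exists (fun j x => U j x /\ W j x).
- by move=> i; split; exact: sub0.
- by move=> i x y [Ux Wx] [Uy Wy]; split; exact: subD.
- by move=> i a x [Ux Wx]; split; exact: subZ.
- by move=> i j f x [Ux Wx]; split; exact: sub_act.
Defined.

(** The sum of [U] and the submodule generated by [v]. *)
Definition sub_adjoin (U : submodule V) (i : Ob) (v : V i) : submodule V.
Proof.
exists (fun j x => exists a : {ffun hom C i j -> k^o}, U j (x - comb v a)).
- by move=> j; exists 0; rewrite comb0 subr0; exact: sub0.
- move=> j x y [a Ua] [b Ub]; exists (a + b).
  by rewrite combD opprD addrACA; exact: subD.
- by move=> j c x [a Ua]; exists (c *: a); rewrite combZ -scalerBr; exact: subZ.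
- move=> j l f x [a Ua]; exists (push f a).
  by rewrite comb_push -linearB; exact: sub_act.
Defined.

(** The preimage of [W + U] under [comb v]. *)
Definition sub_pull (U W : submodule V) (i : Ob) (v : V i) :
  submodule (free_module k C i).
Proof.
exists (fun j (a : {ffun hom C i j -> k^o}) => exists w, W j w /\ U j (w - comb v a)).
- by move=> j; exists 0; rewrite comb0 subr0; split; exact: sub0.
- move=> j a b [w [Ww Ua]] [z [Wz Ub]]; exists (w + z); split; first exact: subD.
  by rewrite combD opprD addrACA; exact: subD.
- move=> j c a [w [Ww Ua]]; exists (c *: w); split; first exact: subZ.
  by rewrite combZ -scalerBr; exact: subZ.
- move=> j l f a [w [Ww Ua]]; exists (act V f w); split; first exact: sub_act.
  by rewrite /= comb_push -linearB; exact: sub_act.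
Defined.

End HomogeneousGenerators.

(** * From free modules to finitely generated modules *)

Section Noetherianity.
Variables (k : fieldType) (Ob : eqType) (C : lfCategory Ob) (V : catModule k C).
Hypothesis free_noetherian :
  forall i (X : submodule (free_module k C i)), hom_generated X.

(* [sub_pull U W v] is finitely generated; lifting its generators to [W] and
   adding generators of the intersection of [W] and [U] generates [W]. *)
Lemma sub_adjoin_noetherian (U : submodule V) (i : Ob) (v : V i) :
  (forall W, sub_le W U -> hom_generated W) ->
  forall W, sub_le W (sub_adjoin U v) -> hom_generated W.
Proof.
move=> Unoeth W WU.
have [t [Xt genX]] := free_noetherian (sub_pull U W v).
(* [s] collects, for each generator in [t], an element of [W] congruent modulo [U] to its image
   under [comb v]. *)
have [s [Ws st]] : exists s, contains_all W s /\
    forall Z : submodule V, contains_all Z s -> contains_all (sub_pull U Z v) t.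
  elim: t Xt {genX} => [|p t IHt] /= Xt; first by exists [::].
  have [[w [Ww Uw]] /IHt[s [Ws st]]] := (contains_all_cons _ _ _).1 Xt.
  exists (homogeneous w :: s); split; first exact/contains_all_cons.
  move=> Z /contains_all_cons[Zw /st Zt].
  by apply/contains_all_cons; split=> //; exists w.
have [s' [Ws' genUW]] : hom_generated (sub_cap W U) by apply: Unoeth => j x [].
exists (s ++ s'); split.
  by apply/contains_all_cat; split=> // p /Ws'[].
move=> Z /contains_all_cat[Zs Zs'] j x Wx.
have [a Ua] := WU j x Wx.
(* Testing with [sub_cap Z W] puts the lift [w] in [W] as well. Since [x] and [w] are both congruent
   to [comb v a] modulo [U], [x - w] lies in [sub_cap W U]. *)
have ZWs : contains_all (sub_cap Z W) s by move=> p ps; split; [exact: Zs | exact: Ws].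
have [|w [[Zw Ww] Uw]] := genX _ (st _ ZWs) j a; first by exists x.
have -> : x = w + (x - w) by rewrite addrC subrK.
apply: subD => //; apply: genUW => //; split.
  by apply: subD => //; rewrite -scaleN1r; exact: subZ.
have -> : x - w = (x - comb v a) - (w - comb v a) by rewrite opprB addrA subrK.
by apply: subD => //; rewrite -scaleN1r; exact: subZ.
Qed.

(** Starting from zero, generators are adjoined one by one while all submodules stay finitely
    generated; the result contains every generator, so it is all of [V]. *)
Lemma hom_generated_noetherian (W : submodule V) :
  hom_generated (sub_full V) -> hom_generated W.
Proof.
case=> s [_ genV].
suff [U [Us Unoeth]] : exists U : submodule V, contains_all U s /\
    forall W, sub_le W U -> hom_generated W.
  by apply: Unoeth => j x _; exact: genV.
elim: s {genV} => [|[i v] s [U [Us Unoeth]]].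
  exists (sub_zero V); split=> // X X0; exists [::]; split=> // U _ j x /X0 ->.
  exact: sub0.
exists (sub_adjoin U v); split; last exact: sub_adjoin_noetherian.
apply/contains_all_cons; split=> /= [|p ps].
  by exists (delta k (idm i)); rewrite comb_id subrr; exact: sub0.
by exists 0; rewrite comb0 subr0; exact: Us.
Qed.

End Noetherianity.

(** Bases of the finitely many degrees up to the stabilization bound generate X, since each later
    degree is generated by the previous one. *)
Lemma free_module_noetherian (C : lfCategory nat) (C_EI : EI C) (C_skel : skeletal C)
    (C_Ainf : type_Ainf C) (C_trans : transitivity_condition C)
    (C_bij : bijectivity_condition C)
    (k : fieldType) (k_char0 : [pchar k] =i pred0)
    (i : nat) (X : submodule (free_module k C i)) :
  hom_generated X.
Proof.
have [alpha /(_ i)[N bij]] := C_bij.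
have [M stableM] := free_module_stabilizes C_EI C_skel C_Ainf C_trans k_char0 X bij.
(* [M.+1] makes the list cover the offset [M] itself, where [stableM] takes over. *)
have [s [Xs gens]] : exists s, contains_all X s /\
    forall U : submodule (free_module k C i), contains_all U s ->
      forall n, (n < M.+1)%N -> forall x, X (n + i)%N x -> U (n + i)%N x.
  elim: M.+1 => [|m [s [Xs gens]]]; first by exists [::].
  have [E EX] := @vspace_of_predicate k {ffun hom C i (m + i)%N -> k^o}
    (X (m + i)%N) (sub0 X _) (@subD _ _ _ _ X _) (@subZ _ _ _ _ X _).
  exists ([seq @homogeneous _ _ _ (free_module k C i) (m + i)%N b
            | b <- vbasis E] ++ s).
  split=> [|U /contains_all_cat[UE Us] n].
    apply/contains_all_cat; split=> // _ /mapP[b bE ->].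
    by apply/EX; exact: vbasis_mem.
  rewrite ltnS leq_eqVlt => /predU1P[-> | ltnm]; last exact: gens.
  move=> x /EX /coord_vbasis ->; apply: (big_ind (U (m + i)%N)).
  - exact: sub0.
  - exact: subD.
  - move=> e _; apply: subZ.
    apply: (UE (@homogeneous _ _ _ (free_module k C i) (m + i)%N (vbasis E)`_e)).
    by apply: map_f; rewrite mem_nth // size_tuple.
exists s; split=> // U Us j.
have XU n x : X (n + i)%N x -> U (n + i)%N x.
  elim: n x => [|n IHn]; first exact: gens.
  by have [/gens|/stableM] := ltnP n.+1 M.+1; auto.
have [leij|ltji] := leqP i j; first by rewrite -(subnK leij); exact: XU.
(* Below degree [i] there are no morphisms from [i], so the space is zero. *)
move=> x _; have -> : x = 0; last exact: sub0.
apply/ffunP => f; have := hom_leq C_EI C_skel alpha f.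
by rewrite leqNgt ltji.
Qed.

Theorem theorem3p7 (C : lfCategory nat) (C_EI : EI C) (C_skel : skeletal C)
    (C_Ainf : type_Ainf C) (C_trans : transitivity_condition C)
    (C_bij : bijectivity_condition C)
    (k : fieldType) (k_char0 : [pchar k]%R =i pred0)
    (V : catModule k C) (V_fg : finitely_generated V) :
  noetherian V.
Proof.
move=> W; apply: hom_generated_fg.
apply: hom_generated_noetherian (finitely_generated_hom V_fg) => i X.
exact: free_module_noetherian.
Qed.
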